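(* Let $P_m$ denote the path on $m$ vertices. If $t\ge 4k\ge 8$ are integers, then $\chi_{\mu_i}(P_t\boxtimes P_{4k})=\frac{\operatorname{diag}(P_t\boxtimes P_{4k})}{2}=2k$. Moreover, $\chi_{\mu_i}(P_t\boxtimes P_r)=4$ for all integers $t\ge r$ with $r\in\{3,4,5,6,7\}$.
   Context: All graphs are finite and simple. The strong product $G\boxtimes H$ has vertex set $V(G)\times V(H)$, with distinct $(g,h),(g',h')$ adjacent iff ($g=g'$ or $gg'\in E(G)$) and ($h=h'$ or $hh'\in E(H)$). A subgraph is convex if every geodesic (shortest path) between two of its vertices lies entirely in it; a convex path is a path subgraph that is convex. If $g_1\dots g_k$ and $h_1\dots h_k$ are convex paths in $G$ and $H$, the subgraph of $G\boxtimes H$ induced by $\{(g_1,h_1),\dots,(g_k,h_k)\}$ is a diagonal; $\operatorname{diag}(G\boxtimes H)$ is the maximum number of vertices of a diagonal. For $X\subseteq V$, two vertices $x,y\in X$ are $X$-visible if some $x,y$-geodesic has no internal vertex in $X$; $X$ is an independent mutual-visibility (IMV) set if $X$ is independent and every two of its vertices are $X$-visible. $\chi_{\mu_i}$ is the least $k$ such that the vertex set can be partitioned into $k$ IMV sets. *)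

(* Defs.v *)
From mathcomp Require Import all_boot.
Set Implicit Arguments.
Unset Strict Implicit.
Unset Printing Implicit Defensive.

Record sgraph := SGraph {
  vertex :> finType;
  adj : rel vertex;
  adj_sym : symmetric adj;
  adj_irr : irreflexive adj }.

Section PathGraph.
Variable m : nat.

Definition path_adj : rel 'I_m := [rel i j : 'I_m | (i.+1 == j) || (j.+1 == i)].

Lemma path_adj_sym : symmetric path_adj.
Proof. by move=> i j; rewrite /path_adj /= orbC. Qed.

Lemma path_adj_irr : irreflexive path_adj.
Proof. by move=> i; rewrite /path_adj /= orbb (gtn_eqF (ltnSn i)). Qed.

Definition path_graph : sgraph := SGraph path_adj_sym path_adj_irr.

End PathGraph.

Section StrongProduct.
Variables G H : sgraph.

Definition strong_adj : rel (G * H)%type :=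
  [rel u v | [&& u != v, (u.1 == v.1) || adj u.1 v.1
                       & (u.2 == v.2) || adj u.2 v.2]].

Lemma strong_adj_sym : symmetric strong_adj.
Proof.
move=> u v; rewrite /strong_adj /=.
by rewrite eq_sym (eq_sym u.1) (eq_sym u.2) (adj_sym u.1) (adj_sym u.2).
Qed.

Lemma strong_adj_irr : irreflexive strong_adj.
Proof. by move=> u; rewrite /strong_adj /= eqxx. Qed.

Definition strong_product : sgraph := SGraph strong_adj_sym strong_adj_irr.

End StrongProduct.

Section Geodesics.
Variable G : sgraph.
Implicit Types (x y : G) (p q : seq G) (X : {set G}).

(* As in the library's [path], the path with vertices x :: p is given by its
   starting point x and by p; its length is then size p. *)
Definition path_between x y p : bool :=
  [&& path (@adj G) x p, uniq (x :: p) & last x p == y].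

Definition geodesic x y p : bool :=
  path_between x y p &&
  [forall n : 'I_(size p), forall q : n.-tuple G, ~~ path_between x y q].

Lemma geodesicP x y p :
  reflect (path_between x y p /\
           forall q, path_between x y q -> size p <= size q)
          (geodesic x y p).
Proof.
apply: (iffP andP) => -[pp minp]; split=> //.
  move=> q pq; rewrite leqNgt; apply/negP => ltqp.
  by move/forallP/(_ (Ordinal ltqp))/forallP/(_ (in_tuple q)): minp; rewrite pq.
apply/forallP => n; apply/forallP => q; apply/negP => /minp.
by rewrite size_tuple leqNgt ltn_ord.
Qed.

Lemma geodesic_size x y p : geodesic x y p -> size p < #|G|.
Proof.
case/andP => /and3P[_ /card_uniqP eq_card _] _.
by rewrite -[size p < _]/(size (x :: p) <= _) -eq_card max_card.
Qed.

Definition internal x p : seq G := behead (belast x p).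

(* The bound n < #|G| loses nothing, see visibleP. *)
Definition visible X x y : bool :=
  [exists n : 'I_#|G|, exists p : n.-tuple G,
    geodesic x y p && all [predC X] (internal x p)].

Lemma visibleP X x y :
  reflect (exists2 p, geodesic x y p & {in internal x p, forall z, z \notin X})
          (visible X x y).
Proof.
apply: (iffP existsP) => [[n /existsP[p /andP[gp /allP Xp]]] | [p gp Xp]].
  by exists p.
exists (Ordinal (geodesic_size gp)); apply/existsP; exists (in_tuple p).
by rewrite gp; apply/allP.
Qed.

Definition independent X : bool :=
  [forall x in X, forall y in X, ~~ adj x y].

Definition imv X : bool :=
  independent X && [forall x in X, forall y in X, (x != y) ==> visible X x y].

(* A subgraph is given by its vertex set S and its edge relation F. *)
Definition convex_subgraph (S : {set G}) (F : rel G) : bool :=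
  [forall x in S, forall y in S,
     forall n : 'I_#|G|, forall p : n.-tuple G,
       geodesic x y p ==> all (mem S) p && path F x p].

Lemma convex_subgraphP (S : {set G}) (F : rel G) :
  reflect (forall x y p, x \in S -> y \in S -> geodesic x y p ->
             {subset p <= S} /\ path F x p)
          (convex_subgraph S F).
Proof.
apply: (iffP idP) => [cS x y p xS yS gp | cS].
  move: cS => /forall_inP/(_ x xS)/forall_inP/(_ y yS).
  move=> /forallP/(_ (Ordinal (geodesic_size gp)))/forallP/(_ (in_tuple p)).
  by move=> /implyP/(_ gp)/andP[/allP pS pF].
apply/forall_inP => x xS; apply/forall_inP => y yS.
apply/forallP => n; apply/forallP => p; apply/implyP => gp.
by have [pS ->] := cS x y p xS yS gp; rewrite andbT; apply/allP.
Qed.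

Definition path_subgraph p : bool :=
  [&& p != [::], uniq p & sorted (@adj G) p].

Definition path_edge p : rel G :=
  [rel u v | infix [:: u; v] p || infix [:: v; u] p].

Definition convex_path p : bool :=
  path_subgraph p && convex_subgraph [set x in p] (path_edge p).

End Geodesics.

Section Diagonal.
Variables G H : sgraph.

(* A diagonal, as an induced subgraph, is identified with its vertex set.
   The bound k <= #|G| loses nothing, see diagonalP. *)
Definition diagonal (D : {set strong_product G H}) : bool :=
  [exists k : 'I_#|G|.+1, exists g : k.-tuple G, exists h : k.-tuple H,
    [&& convex_path g, convex_path h & D == [set z in zip g h]]].

Lemma diagonalP (D : {set strong_product G H}) :
  reflect (exists g : seq G, exists h : seq H,
             [/\ size g = size h, convex_path g, convex_path h
               & D = [set z in zip g h]])
          (diagonal D).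
Proof.
apply: (iffP existsP).
  move=> [k /existsP[g /existsP[h /and3P[cg ch /eqP DE]]]].
  by exists g, h; rewrite !size_tuple.
move=> [g [h [eqgh cg ch DE]]].
have szg : size g < #|G|.+1.
  rewrite ltnS; case/andP: (cg) => /and3P[_ /card_uniqP <- _] _.
  exact: max_card.
exists (Ordinal szg); apply/existsP; exists (in_tuple g).
have szh : size h == size g by rewrite eqgh.
by apply/existsP; exists (Tuple szh); rewrite cg ch DE /=.
Qed.

Definition diag : nat := \max_(D | diagonal D) #|D|.

End Diagonal.

Section ImvChromatic.
Variable G : sgraph.

Definition imv_colorable (k : nat) : bool :=
  [exists P : {set {set G}},
    [&& partition P [set: G], [forall X in P, imv X] & #|P| == k]].

Lemma imv_colorable_ex : exists k, imv_colorable k.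
Proof.
pose P := preim_partition (@id G) [set: G].
exists #|P|; apply/existsP; exists P; rewrite preim_partitionP eqxx andbT /=.
have sub1 X x y : X \in P -> x \in X -> y \in X -> x = y.
  by case/imsetP => z _ ->; rewrite !inE /= => /eqP <- /eqP.
apply/forall_inP => X XP; apply/andP; split;
  apply/forall_inP => x xX; apply/forall_inP => y yX.
  by rewrite (sub1 _ _ _ XP xX yX) adj_irr.
by rewrite (sub1 _ _ _ XP xX yX) eqxx.
Qed.

Definition chi_mu_i : nat := ex_minn imv_colorable_ex.

End ImvChromatic.

(* Main.v *)
Require Import Defs.
From mathcomp Require Import all_boot all_order all_algebra.
From mathcomp Require Import zify.
Import GRing.Theory.
Set Implicit Arguments.
Unset Strict Implicit.
Unset Printing Implicit Defensive.

(* Upper bound: for an even m >= 4, colour the vertex (x, y) by y mod m on even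
   columns and by y + 2 mod m on odd columns.  If there are at most 2m rows, a
   colour class lives on at most four rows, all of the same parity, each of them
   met on every second column only.  The rows of the other parity are free
   corridors, and a row of the class can be crossed at every second column, so
   that a geodesic going straight diagonally, delayed by at most one step, joins
   any two vertices of the class.
   Lower bound: two vertices of the main diagonal are joined by a unique
   geodesic, which stays on the diagonal, so an IMV set has at most two vertices
   there; and a 2 x 2 block is a clique. *)

(** * Arithmetic of a colour class *)

Lemma modn_eq_near (m u v : nat) : u < v + 3 * m -> v < u + 3 * m ->
  u = v %[mod m] ->
  [\/ u = v, u = v + m, v = u + m | u = v + 2 * m \/ v = u + 2 * m].
Proof.
move=> uv vu E; have := divn_eq u m; have := divn_eq v m; rewrite E.
move: (u %/ m) (v %/ m) (v %% m) => p q z Ev Eu.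
have [le|lt] := leqP q p.
  have {le}[d Ed] : exists d, p = q + d by exists (p - q); lia.
  have {}Ed : u = v + d * m by rewrite Ev Eu Ed mulnDl; lia.
  case: d Ed => [|[|[|d]]] ?; [constructor 1|constructor 2|constructor 4; left|]; nia.
have {lt}[d Ed] : exists d, q = p + d by exists (q - p); lia.
have {}Ed : v = u + d * m by rewrite Ev Eu Ed mulnDl; lia.
case: d Ed => [|[|[|d]]] ?; [constructor 1|constructor 3|constructor 4; right|]; nia.
Qed.

Definition colour (m x y : nat) := (y + 2 * odd x) %% m.

(* Position, relative to a vertex of a colour class, of the vertices of that
   class that are a columns and b < 2 m rows away; e is 2 or m - 2 according to
   the parity of the starting column and to the vertical direction. *)
Definition occupied (m e a b : nat) : bool :=
  odd a && ((b == e) || (b == m + e)) || ~~ odd a && ((b == 0) || (b == m)).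

Definition shift_row (m x : nat) (up : bool) := if odd x == up then 2 else m - 2.

(** The rows differ by less than 2 * m, but the offset 2 of the odd columns can bring the difference
    of the uncorrected residues to 2 * m; that case gives b = m + e with e = m - 2. *)
Lemma occupiedP (m x y x' y' a b : nat) (up : bool) :
  2 < m -> y < 2 * m -> y' < 2 * m -> (if up then y' = y + b else y = y' + b) ->
  odd x' = odd x (+) odd a -> colour m x' y' = colour m x y ->
  occupied m (shift_row m x up) a b.
Proof.
rewrite /shift_row /occupied /colour => m2 hy hy' eb -> /modn_eq_near E.
have {}E := E ltac:(lia) ltac:(lia); move: E.
by case: up eb; case: (odd x); case: (odd a) => /= eb [|||[]]; lia.
Qed.

(** Only the even rows 0, e, m and m + e can be occupied, so every odd row is free. The longer
    coordinate advances at each step, and the shorter one is timed to meet the even rows at free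
    columns. *)
Lemma free_walk (m e dx dy : nat) :
  ~~ odd m -> ~~ odd e -> 1 < e < m -> 0 < dy -> occupied m e dx dy ->
  let n := maxn dx dy in
  exists a b : nat -> nat,
    [/\ [/\ a 0 = 0, b 0 = 0, a n = dx & b n = dy],
        forall s, s < n -> a s <= a s.+1 <= (a s).+1 /\ b s <= b s.+1 <= (b s).+1,
        forall s, s < n -> a s < a s.+1 \/ b s < b s.+1,
        forall s, s <= n -> a s <= dx /\ b s <= dy
      & forall s, 0 < s < n -> ~~ occupied m e (a s) (b s)].
Proof.
move=> om oe em dy0 + n; rewrite /occupied.
have [vert|horiz] := leqP dx dy.
  have -> : n = dy by lia.
  move=> occ; have : (dy <= m) || odd dx && (dy == m + e) by lia.
  case/orP=> [short|/andP[odx /eqP long]].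
    (* Row e is crossed at displacement min(e, dx), which is even: an odd dx puts the target itself
       on row e. *)
    exists (fun s => minn s dx), id; move: occ.
    by split=> [|s|s|s|s]; [split; lia|lia..].
  (* The occupied rows e and m must be crossed at an even and at an odd
     horizontal displacement respectively, hence the delay at step m. *)
  exists (fun s => if s < m then minn s dx.-1 else minn s.-1 dx), id.
  by split=> [|s|s|s|s]; [split|..]; do ?case: ifP; lia.
have -> : n = dx by lia.
move=> occ; have : (dy <= m) || odd dx && (dy == m + e) by lia.
case/orP=> [short|/andP[odx /eqP long]].
  (* The walk waits on the odd row dy - 1 and enters the target row at the last step only. *)
  exists id, (fun s => if s < dx then minn s dy.-1 else dy); move: occ.
  by split=> [|s|s|s|s]; [split|..]; do ?case: ifP; lia.
(* One more step on the odd row m - 1 makes the walk cross row m at the odd displacement m + 1. *)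
exists id, (fun s => if s < m then s else if s < dx then minn s.-1 dy.-1 else dy).
by split=> [|s|s|s|s]; [split|..]; do ?case: ifP; lia.
Qed.

(** * Walks, geodesics and Lipschitz functions *)

Lemma walk_path (G : sgraph) (w : nat -> G) n :
  (forall s, s < n -> adj (w s) (w s.+1)) ->
  path (@adj G) (w 0) [seq w s | s <- iota 1 n] /\
  last (w 0) [seq w s | s <- iota 1 n] = w n.
Proof.
move=> adjw; set p := [seq _ | _ <- _].
have szp : size p = n by rewrite size_map size_iota.
split.
  apply/(pathP (w 0)) => i; rewrite szp => lin.
  rewrite (nth_map 0) ?size_iota // nth_iota // add1n.
  case: i lin => [|i] lin /=; first exact: adjw.
  by rewrite (nth_map 0) ?size_iota ?nth_iota ?add1n; [exact: adjw|lia..].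
rewrite (last_nth (w 0)) szp; case: n @p {adjw szp} => [//|n] p /=.
by rewrite (nth_map 0) ?size_iota ?nth_iota.
Qed.

(** Shortening a walk to a path cannot lower a length that is already minimal, so the walk repeats
    no vertex. *)
Lemma walk_geodesic (G : sgraph) (w : nat -> G) n :
  (forall s, s < n -> adj (w s) (w s.+1)) ->
  (forall q, path_between (w 0) (w n) q -> n <= size q) ->
  geodesic (w 0) (w n) [seq w s | s <- iota 1 n].
Proof.
move=> /walk_path[]; set p := [seq _ | _ <- _] => pp lp minw.
have szp : size p = n by rewrite size_map size_iota.
apply/geodesicP; split=> [|q /minw]; last by rewrite szp.
apply/and3P; split=> //; last by rewrite lp.
move: lp; case/shortenP: pp => p' pp' /= /andP[w0p' up'] sub lp.
have le_pp' : size p <= size p'.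
  by rewrite szp; apply: minw; rewrite /path_between pp' /= w0p' up' lp eqxx.
have [_ eqpp'] := uniq_min_size up' sub le_pp'.
by rewrite -(eqpp' (w 0)) w0p' (leq_size_uniq up' sub le_pp').
Qed.

Lemma geodesic_le_walk (G : sgraph) (w : nat -> G) n p :
  (forall s, s < n -> adj (w s) (w s.+1)) -> geodesic (w 0) (w n) p -> size p <= n.
Proof.
move=> /walk_path[]; set q := [seq _ | _ <- _] => pq lq /geodesicP[_ minp].
have <- : size q = n by rewrite size_map size_iota.
move: lq; case/shortenP: pq => q' pq' uq' sub lq.
apply: leq_trans (minp q' _) (uniq_leq_size _ sub); last by case/andP: uq'.
by rewrite /path_between pq' uq' lq eqxx.
Qed.

Lemma visible_walk (G : sgraph) (X : {set G}) (w : nat -> G) n :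
  (forall s, s < n -> adj (w s) (w s.+1)) ->
  (forall q, path_between (w 0) (w n) q -> n <= size q) ->
  (forall s, 0 < s < n -> w s \notin X) ->
  visible X (w 0) (w n).
Proof.
move=> adjw minw wX; apply/visibleP.
exists [seq w s | s <- iota 1 n]; first exact: walk_geodesic.
case: n adjw minw wX => [//|n] _ _ wX z.
have -> : internal (w 0) [seq w s | s <- iota 1 n.+1] = [seq w s | s <- iota 1 n].
  by rewrite /internal -(addn1 n) iotaD map_cat /= cats1 belast_rcons.
by case/mapP => s; rewrite mem_iota => hs ->; apply: wX; lia.
Qed.

(** Coordinates are Lipschitz on edges. This bounds path lengths from below and locates each vertex
    of a geodesic from both ends. *)
Lemma path_lipschitz (G : sgraph) (phi : G -> nat) x p i j :
  (forall u v, adj u v -> phi v <= (phi u).+1) ->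
  path (@adj G) x p -> i <= j <= size p ->
  phi (nth x (x :: p) j) <= phi (nth x (x :: p) i) + (j - i) /\
  phi (nth x (x :: p) i) <= phi (nth x (x :: p) j) + (j - i).
Proof.
move=> lip /(pathP x) pp; elim: j => [|j IHj] /andP[ij jp].
  by have -> : i = 0; lia.
have [-> | ltij] := eqVneq i j.+1; first by lia.
have adj_j := pp j jp.
have := IHj ltac:(lia); have := lip _ _ adj_j.
have := lip _ _ (etrans (adj_sym _ _) adj_j).
by rewrite /= -/(nth x (x :: p) j); lia.
Qed.

Lemma path_between_lipschitz (G : sgraph) (phi : G -> nat) x y q :
  (forall u v, adj u v -> phi v <= (phi u).+1) ->
  path_between x y q -> phi y <= phi x + size q /\ phi x <= phi y + size q.
Proof.
move=> lip /and3P[pq _ /eqP <-].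
have := path_lipschitz (i := 0) (j := size q) lip pq ltac:(lia).
by rewrite (last_nth x) /= subn0.
Qed.

(** * Coordinates in the grid *)

Lemma path_graph_lipschitz m (u v : path_graph m) : adj u v -> v <= u.+1.
Proof. by rewrite /adj /= => /orP[]/eqP; lia. Qed.

Local Notation grid t r := (strong_product (path_graph t) (path_graph r)) (only parsing).

Definition column t r (u : grid t r) : nat := u.1.
Definition row t r (u : grid t r) : nat := u.2.

Lemma ltn_column t r (u : grid t r) : column u < t. Proof. exact: ltn_ord. Qed.
Lemma ltn_row t r (u : grid t r) : row u < r. Proof. exact: ltn_ord. Qed.

Lemma grid_eq t r (u v : grid t r) : column u = column v -> row u = row v -> u = v.
Proof. by case: u v => [i j] [i' j']; rewrite /column /row /= => /val_inj -> /val_inj ->. Qed.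

(** The strong product of two paths is the king's graph. *)
Lemma grid_adjP t r (u v : grid t r) :
  reflect [/\ u != v, column u <= (column v).+1 /\ column v <= (column u).+1
            & row u <= (row v).+1 /\ row v <= (row u).+1]
          (adj u v).
Proof.
have E m (i j : path_graph m) : (i == j) || adj i j = (i <= j.+1) && (j <= i.+1).
  rewrite -[i == j]/(nat_of_ord i == j) -[adj i j]/((i.+1 == j) || (j.+1 == i)).
  by lia.
apply: (iffP and3P) => -[-> h1 h2]; split=> //; move: h1 h2; rewrite !E.
all: by [move=> /andP[? ?] /andP[? ?] | case=> ? ? [? ?]; apply/andP].
Qed.

Lemma column_lipschitz t r (u v : grid t r) : adj u v -> column v <= (column u).+1.
Proof. by case/grid_adjP => _ [_ ->]. Qed.

Lemma row_lipschitz t r (u v : grid t r) : adj u v -> row v <= (row u).+1.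
Proof. by case/grid_adjP => _ _ [_ ->]. Qed.

(** The walk is shortest because its length equals the total change of one coordinate, which no path
    can achieve in fewer steps. *)
Lemma grid_visible t r (X : {set grid t r}) (u v : grid t r) (a b : nat -> nat) n :
  [/\ a 0 = column u, b 0 = row u, a n = column v & b n = row v] ->
  (forall s, s <= n -> a s < t /\ b s < r) ->
  (forall s, s < n -> [/\ a s <= (a s.+1).+1, a s.+1 <= (a s).+1,
                        b s <= (b s.+1).+1 & b s.+1 <= (b s).+1]) ->
  (forall s, s < n -> a s != a s.+1 \/ b s != b s.+1) ->
  [\/ column u + n = column v, column v + n = column u,
      row u + n = row v | row v + n = row u] ->
  (forall s (z : grid t r), 0 < s < n -> column z = a s -> row z = b s ->
     z \notin X) ->
  visible X u v.
Proof.
move=> [a0 b0 an bn] rng lip move_ab len abX.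
(* For s <= n both coordinates are in range, so the default values do not show up. *)
pose w s : grid t r := (insubd u.1 (a s), insubd u.2 (b s)).
have w1 s : s <= n -> column (w s) = a s.
  by move=> /rng[h _]; rewrite /w /column /row /= insubdK.
have w2 s : s <= n -> row (w s) = b s.
  by move=> /rng[_ h]; rewrite /w /column /row /= insubdK.
have eqw s (z : grid t r) : s <= n -> a s = column z -> b s = row z -> w s = z.
  by move=> sn e1 e2; apply: grid_eq; [rewrite w1|rewrite w2].
rewrite -(eqw 0 u) // -(eqw n v) //; apply: visible_walk => [s sn|q|s sn].
- apply/grid_adjP; rewrite !w1 ?w2; [|lia..]; case: (lip s sn) => *; split=> //.
  apply/eqP => ew; have sn' := ltnW sn; have := move_ab s sn.
  by rewrite -!w1 // -!w2 // ew !eqxx => -[].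
- rewrite (eqw 0 u) // (eqw n v) // => pq.
  have := path_between_lipschitz (@column_lipschitz t r) pq.
  have := path_between_lipschitz (@row_lipschitz t r) pq.
  by case: len => /=; lia.
- by apply: (abX s); rewrite ?w1 ?w2 //; lia.
Qed.

(** * Colour classes are IMV sets *)

(** A Boolean direction lets one argument treat all four quadrants around a vertex. *)
Lemma nat_directed_dist (x y : nat) :
  exists (up : bool) d, if up then y = x + d else x = y + d.
Proof. by case: (leqP x y) => ?; [exists true, (y - x)|exists false, (x - y)]; lia. Qed.

Lemma odd_directed_dist (x y d : nat) (up : bool) :
  (if up then y = x + d else x = y + d) -> odd y = odd x (+) odd d.
Proof. by case: up => ->; rewrite oddD -?addbA ?addbb ?addbF. Qed.

Lemma monochromatic_imv t r m (X : {set grid t r}) :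
  ~~ odd m -> 2 < m -> 1 < r <= 2 * m ->
  {in X &, forall u v : grid t r,
     colour m (column u) (row u) = colour m (column v) (row v)} ->
  imv X.
Proof.
move=> om m2 /andP[r1 rm] colX.
have occ (u v : grid t r) a b (up : bool) : u \in X -> v \in X ->
    odd (column v) = odd (column u) (+) odd a ->
    (if up then row v = row u + b else row u = row v + b) ->
    occupied m (shift_row m (column u) up) a b.
  move=> uX vX par ord.
  apply: (occupiedP (x' := column v) m2 _ _ ord par); last exact: colX;
    exact: leq_trans (ltn_row _) rm.
have e_bounds x up : ~~ odd (shift_row m x up) && (1 < shift_row m x up < m).
  by rewrite /shift_row; case: ifP; lia.
(* From here on only the parity of the shift and its bounds matter. *)
move: (shift_row m) e_bounds occ => e e_bounds occ.
apply/andP; split; apply/forall_inP => u uX; apply/forall_inP => v vX;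
  have [rt [dx hx]] := nat_directed_dist (column u) (column v);
  have [up [dy hy]] := nat_directed_dist (row u) (row v);
  have par := odd_directed_dist hx.
all: have := occ u v dx dy up uX vX par hy; have := e_bounds (column u) up.
all: have [f Ef] : exists f, e (column u) up = f by eexists.
all: rewrite Ef => /andP[ef f_bounds] occ_uv.
  apply/negP => /grid_adjP[/eqP nuv [h1 h2] [h3 h4]].
  (* As 1 < e < m, the only occupied position at distance at most one is the origin. *)
  apply: nuv; have [dx0 dy0] : dx = 0 /\ dy = 0.
    by move: occ_uv; rewrite /occupied; case: rt hx => hx; case: up {Ef} hy => hy; lia.
  by apply: grid_eq; [case: rt hx|case: up {Ef} hy]; lia.
apply/implyP => nuv.
have {}nuv : 0 < dx + dy.
  rewrite lt0n; apply: contraNneq nuv => d0; apply/eqP.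
  by apply: grid_eq; [case: rt hx|case: up {Ef} hy]; lia.
have [ut ur] := (ltn_column u, ltn_row u); have [vt vr] := (ltn_column v, ltn_row v).
have [dy0|dy0] := posnP dy.
  (* On a common row the geodesic makes a detour through an adjacent row, which
     is free because the rows of the class all have the same parity. *)
  have odx : ~~ odd dx by move: occ_uv; rewrite /occupied; lia.
  pose b s := if 0 < s < dx then (if 0 < row u then (row u).-1 else (row u).+1) else row u.
  have b_far s : 0 < s < dx -> if 0 < row u then b s = (row u).-1 else b s = (row u).+1.
    by move=> hs; rewrite /b hs; case: (0 < row u).
  have b_rng s : b s < r by rewrite /b; do 2?case: ifP; lia.
  have b_lip s s' : b s <= (b s').+1 by rewrite /b; do 4?case: ifP; lia.
  apply: (@grid_visible _ _ X u v (fun s => if rt then column u + s else column u - s) b dx).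
  - split; rewrite /b ?ltnn ?andbF /=; [case: rt hx|by []|case: rt hx|case: up {Ef} hy]; lia.
  - by move=> s sn; split=> //; case: rt hx; lia.
  - by move=> s sn; split=> //; case: rt hx; lia.
  - by move=> s sn; left; case: rt hx; lia.
  - by case: rt hx => hx; [constructor 1|constructor 2]; lia.
  move=> s z hs z1 z2; apply/negP => zX.
  have hz : if row u == 0 then row z = row u + 1 else row u = row z + 1.
    by have := b_far s hs; rewrite z2; do 2!case: ifP; lia.
  have /odd_directed_dist parz :
      if rt then column z = column u + s else column u = column z + s.
    by rewrite z1; case: rt {z1} hx => hx; lia.
  (* A vertex of X one row away from u is impossible: 1 is none of 0, m, e, m + e. *)
  have := occ u z s 1 _ uX zX parz hz; have := e_bounds (column u) (row u == 0).
  by move: (e _ _) => f'; clear -m2; rewrite /occupied; lia.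
have [a [b [[a0 b0 an bn] lip mv rng free]]] := free_walk om ef f_bounds dy0 occ_uv.
(* The walk of [free_walk] is reflected into the quadrant of v as seen from u. *)
apply: (@grid_visible _ _ X u v (fun s => if rt then column u + a s else column u - a s)
    (fun s => if up then row u + b s else row u - b s) (maxn dx dy)).
- rewrite a0 b0 an bn.
  by split; [case: rt hx|case: up {Ef} hy|case: rt hx|case: up {Ef} hy]; lia.
- by move=> s /rng[]; split; [case: rt hx|case: up {Ef} hy]; lia.
- by move=> s /lip[]; split; [case: rt hx|case: rt hx|case: up {Ef} hy|case: up {Ef} hy]; lia.
- move=> s hs; have [ha hb] := lip s hs; have [ha' hb'] := rng _ hs.
  by case: (mv s hs) => h; [left; case: rt hx|right; case: up {Ef} hy]; lia.
- have [_|_] := leqP dx dy; [case: up {Ef} hy|case: rt hx] => h;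
    [constructor 3|constructor 4|constructor 1|constructor 2]; lia.
move=> s z hs z1 z2; apply/negP => zX.
have [ha hb] := rng s ltac:(lia).
have /odd_directed_dist parz :
    if rt then column z = column u + a s else column u = column z + a s.
  by rewrite z1; case: rt {z1} hx => hx; lia.
have hz : if up then row z = row u + b s else row u = row z + b s.
  by rewrite z2; case: up {z2 Ef} hy => hy; lia.
by have /negP := free s hs; apply; rewrite -Ef; apply: occ parz hz.
Qed.

(** * Colourings and counting bounds *)

Lemma chi_mu_i_le (G : sgraph) k (f : G -> 'I_k) :
  (forall c, imv [set x | f x == c]) -> chi_mu_i G <= k.
Proof.
move=> imvf; pose P := preim_partition f [set: G].
have clsE X : X \in P -> exists c, X = [set x | f x == c].
  case/imsetP => x _ ->; exists (f x).
  by apply/setP => y; rewrite !inE /= eq_sym.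
have leP : #|P| <= k.
  have sub : P \subset [set [set x | f x == c] | c : 'I_k].
    by apply/subsetP => X /clsE[c ->]; apply: imset_f.
  apply: leq_trans (subset_leq_card sub) (leq_trans (leq_imset_card _ _) _).
  by rewrite card_ord.
rewrite /chi_mu_i; case: ex_minnP => n _ minn; apply: leq_trans leP; apply: minn.
apply/existsP; exists P; rewrite preim_partitionP eqxx andbT /=.
by apply/forall_inP => X /clsE[c ->].
Qed.

(** S is counted part by part in an optimal partition. It will be a clique with m = 1 and the main
    diagonal with m = 2. *)
Lemma chi_mu_i_ge (G : sgraph) (S : {set G}) m :
  (forall X, imv X -> #|X :&: S| <= m) -> #|S| <= m * chi_mu_i G.
Proof.
move=> leX; rewrite /chi_mu_i; case: ex_minnP => n /existsP[P /and3P[partP imvP /eqP <-]] _.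
rewrite -sum1_card.
have -> : \sum_(x in S) 1 = \sum_(x in [set: G] | x \in S) 1.
  by apply: eq_bigl => x; rewrite inE.
rewrite (set_partition_big_cond _ partP) mulnC -sum_nat_const.
apply: leq_sum => X XP; have := leX X (forall_inP imvP X XP).
by rewrite -sum1_card; congr (_ <= _); apply: eq_bigl => x; rewrite inE.
Qed.

Lemma chi_grid_le t r m : ~~ odd m -> 2 < m -> 1 < r <= 2 * m -> chi_mu_i (grid t r) <= m.
Proof.
move=> om m2 hr; have m0 : 0 < m by lia.
pose f (u : grid t r) := Ordinal (ltn_pmod (row u + 2 * odd (column u)) m0).
apply: (@chi_mu_i_le _ m f) => c; apply: (monochromatic_imv om m2 hr) => u v.
by rewrite !inE => /eqP <- /eqP/(congr1 val).
Qed.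

Lemma chi_grid_ge4 t r : 1 < t -> 1 < r -> 4 <= chi_mu_i (grid t r).
Proof.
move=> t1 r1; pose S := [set u : grid t r | (column u < 2) && (row u < 2)].
rewrite -[chi_mu_i _]mul1n; apply: leq_trans (chi_mu_i_ge (S := S) _).
  pose f (z : 'I_2 * 'I_2) : grid t r := (widen_ord t1 z.1, widen_ord r1 z.2).
  have injf : injective f.
    by move=> [i j] [i' j'] [] /= e1 e2; congr (_, _); apply: val_inj.
  have <- : #|[set f z | z : 'I_2 * 'I_2]| = 4.
    by rewrite card_imset // card_prod card_ord.
  apply: subset_leq_card; apply/subsetP => _ /imsetP[z _ ->].
  by rewrite inE /column /row /= !ltn_ord.
move=> X /andP[/forall_inP indX _]; apply/card_le1_eqP => u v.
rewrite !inE => /andP[uX /andP[u1 u2]] /andP[vX /andP[v1 v2]].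
apply/eqP; move/forall_inP: (indX v vX) => /(_ u uX); apply: contraNT => nuv.
by apply/grid_adjP; split=> //; lia.
Qed.

(** * Geodesics along the main diagonal *)

(** Both coordinates must grow by n in n steps, so every step is forced to be diagonal. *)
Lemma geodesic_diagonal t r (u v : grid t r) p n :
  column u + n = column v -> row u + n = row v -> geodesic u v p ->
  size p = n /\ forall i, i <= n ->
    column (nth u (u :: p) i) = column u + i /\ row (nth u (u :: p) i) = row u + i.
Proof.
move=> e1 e2 geo; have [cv rv] := (ltn_column v, ltn_row v).
have szp : size p <= n.
  pose w s : grid t r := (insubd u.1 (column u + s), insubd u.2 (row u + s)).
  have w1 s : s <= n -> column (w s) = column u + s.
    by move=> sn; rewrite /w {1}/column /= insubdK // -topredE /=; lia.
  have w2 s : s <= n -> row (w s) = row u + s.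
    by move=> sn; rewrite /w {1}/row /= insubdK // -topredE /=; lia.
  have w0 : w 0 = u by apply: grid_eq; rewrite ?w1 ?w2 ?addn0.
  have wn : w n = v by apply: grid_eq; rewrite ?w1 ?w2.
  rewrite -w0 -wn in geo; apply: geodesic_le_walk geo => s sn.
  apply/grid_adjP; rewrite !w1 ?w2 //; try exact: ltnW.
  split; [|lia..]; apply/eqP => /(congr1 (@column t r)).
  by rewrite !w1 //; lia.
case/geodesicP: geo => pq _; have /and3P[pp _ /eqP lp] := pq.
have lt1 := path_between_lipschitz (@column_lipschitz t r) pq.
have {}szp : size p = n by lia.
split=> // i lin.
have lv : nth u (u :: p) (size p) = v by rewrite -lp (last_nth u).
have := path_lipschitz (i := 0) (j := i) (@column_lipschitz t r) pp ltac:(lia).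
have := path_lipschitz (i := 0) (j := i) (@row_lipschitz t r) pp ltac:(lia).
have := path_lipschitz (i := i) (j := size p) (@column_lipschitz t r) pp ltac:(lia).
have := path_lipschitz (i := i) (j := size p) (@row_lipschitz t r) pp ltac:(lia).
rewrite lv szp [nth u _ 0]/= => *; lia.
Qed.

Lemma diagonal_blocked t r (X : {set grid t r}) (u v w : grid t r) :
  column u = row u -> column v = row v -> column w = row w ->
  column u < column v < column w -> v \in X -> ~~ visible X u w.
Proof.
move=> du dv dw /andP[uv vw] vX; apply/negP => /visibleP[p geo pX].
have [|//|szp pE] := geodesic_diagonal (n := column w - column u) _ _ geo; [lia|lia|].
pose i := column v - column u; have [c_i r_i] := pE i ltac:(lia).
have vE : nth u (u :: p) i = v by apply: grid_eq; lia.
have /pX : v \in internal u p; last by rewrite vX.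
rewrite -vE /internal.
(* [internal] drops u, which shifts the index by one, and the last vertex, which i < size p does not
   reach. *)
have -> : nth u (u :: p) i = nth u (behead (belast u p)) i.-1.
  rewrite nth_behead prednK; last by lia.
  by rewrite [in LHS]lastI nth_rcons size_belast szp ifT //; lia.
by apply: mem_nth; rewrite size_behead size_belast szp; lia.
Qed.

Lemma chi_grid_ge_diagonal t r : r <= t -> r <= 2 * chi_mu_i (grid t r).
Proof.
move=> rt; pose S := [set u : grid t r | column u == row u].
apply: leq_trans (chi_mu_i_ge (S := S) _).
  pose f (i : 'I_r) : grid t r := (widen_ord rt i, i).
  have injf : injective f by move=> i j [].
  rewrite -{1}(card_ord r) -cardsT -(card_imset _ injf).
  apply: subset_leq_card; apply/subsetP => _ /imsetP[i _ ->].
  by rewrite inE /column /row /= eqxx.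
move=> X /andP[_ /forall_inP visX]; rewrite leqNgt; apply/negP.
case/card_gt2P => x [y [z [[]]]]; rewrite !inE.
move=> /andP[xX /eqP dx] /andP[yX /eqP dy] /andP[zX /eqP dz] [xy yz zx].
have neq (u v : grid t r) : column u = row u -> column v = row v -> u != v ->
    column u < column v \/ column v < column u.
  move=> du dv nuv; apply/orP; rewrite -neq_ltn; apply: contra nuv => /eqP e.
  by apply/eqP; apply: grid_eq; lia.
have vis u v : u \in X -> v \in X -> column u < column v -> visible X u v.
  move=> uX vX uv; have /forall_inP/(_ v vX)/implyP := visX u uX; apply.
  by apply: contraTneq uv => ->; rewrite ltnn.
have no u v w : u \in X -> v \in X -> w \in X -> column u = row u -> column v = row v ->
    column w = row w -> column u < column v -> column v < column w -> False.
  move=> uX vX wX du dv dw uv vw; have uw := ltn_trans uv vw.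
  by apply/negP: (vis u w uX wX uw); apply: (diagonal_blocked (v := v)) => //; rewrite uv.
(* Of the eight sign patterns the two cyclic ones are contradictory; each of the others names the
   middle vertex, which blocks the outer two. *)
case: (neq x y) => //; case: (neq y z) => //; case: (neq z x) => // zx' yz' xy'.
- lia.
- exact: (no x y z).
- exact: (no z x y).
- exact: (no x z y).
- exact: (no y z x).
- exact: (no y x z).
- exact: (no z y x).
- lia.
Qed.

(** * Convex paths and the value of diag *)

(** With n = |x - y|, written by truncated subtractions, the i-th vertex is within i of x and n - i
    of y. *)
Lemma path_graph_geodesic_between t (x y : path_graph t) p z :
  geodesic x y p -> z \in p -> minn x y <= z <= maxn x y.
Proof.
move=> geo zp; pose n := maxn (y - x) (x - y).
have lip u v : @adj (path_graph t) u v -> v <= u.+1 := @path_graph_lipschitz t u v.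
have [tx ty] := (ltn_ord x, ltn_ord y).
have szp : size p <= n.
  pose w s : path_graph t := insubd x (if x <= y then x + s else x - s).
  have wE s : s <= n -> w s = (if x <= y then x + s else x - s) :> nat.
    by move=> sn; rewrite /w insubdK // -topredE /=; case: ifP; lia.
  have w0 : w 0 = x by apply: ord_inj; rewrite wE // addn0 subn0 if_same.
  have wn : w n = y by apply: ord_inj; rewrite wE //; case: ifP; lia.
  rewrite -w0 -wn in geo; apply: geodesic_le_walk geo => s sn.
  rewrite -[adj _ _]/(((w s).+1 == w s.+1 :> nat) || ((w s.+1).+1 == w s :> nat)).
  by rewrite !wE //; [case: ifP; lia|exact: ltnW].
case/geodesicP: geo => /and3P[pp _ /eqP lp] _.
have lv : nth x (x :: p) (size p) = y by rewrite -lp (last_nth x).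
have [i ip <-] : exists2 i, i < size p & nth x (x :: p) i.+1 = z.
  by exists (index z p); rewrite ?index_mem //= nth_index.
have := path_lipschitz (i := 0) (j := i.+1) lip pp ltac:(lia).
have := path_lipschitz (i := i.+1) (j := size p) lip pp ltac:(lia).
by rewrite lv [nth x _ 0]/= /n in szp *; lia.
Qed.

Definition initial_path n t (le_nt : n <= t) : seq (path_graph t) :=
  [seq widen_ord le_nt i | i <- enum 'I_n].

Section InitialPath.
Variables (n t : nat) (le_nt : n <= t).

Lemma val_initial_path : [seq val i | i <- initial_path le_nt] = iota 0 n.
Proof. by rewrite -map_comp -val_enum_ord; apply: eq_map. Qed.

Lemma size_initial_path : size (initial_path le_nt) = n.
Proof. by rewrite size_map size_enum_ord. Qed.

Lemma initial_path_uniq : uniq (initial_path le_nt).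
Proof. by rewrite map_inj_uniq ?enum_uniq // => i j [] /val_inj. Qed.

Lemma mem_initial_path (i : path_graph t) : (i \in initial_path le_nt) = (i < n).
Proof. by rewrite -(mem_map val_inj) val_initial_path mem_iota add0n. Qed.

Lemma infix_initial_path (i j : path_graph t) :
  i.+1 = j :> nat -> j < n -> infix [:: i; j] (initial_path le_nt).
Proof.
move=> ij jn.
suff -> : [:: i; j] = take 2 (drop i (initial_path le_nt)).
  by apply: infix_trans (infix_drop _ _); apply: infix_take.
apply: (inj_map val_inj); rewrite map_take map_drop val_initial_path.
rewrite drop_iota take_iota (minn_idPl _); last by lia.
by rewrite /= add0n -ij.
Qed.

(** A geodesic stays between its ends, hence below n, where adjacent vertices are consecutive in the
    segment. *)
Lemma convex_initial_path : 0 < n -> convex_path (initial_path le_nt).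
Proof.
move=> n0; apply/andP; split.
  apply/and3P; split; rewrite ?initial_path_uniq //.
    by rewrite -size_eq0 size_initial_path -lt0n.
  have -> : sorted (@adj (path_graph t)) (initial_path le_nt) =
      sorted (fun a b => (a.+1 == b) || (b.+1 == a)) (iota 0 n).
    by rewrite -val_initial_path sorted_map.
  case: (n) => //= k; elim: k 0 => //= k IHk i; first by rewrite eqxx IHk.
apply/convex_subgraphP => x y p; rewrite !inE !mem_initial_path => xn yn geo.
have lt_n z : z \in x :: p -> z < n.
  by rewrite inE => /orP[/eqP->//|/(path_graph_geodesic_between geo)]; lia.
split=> [z zp|]; first by rewrite inE mem_initial_path lt_n // inE zp orbT.
case/geodesicP: geo => /and3P[pp _ _] _.
apply: (@sub_in_path _ (fun z : path_graph t => z < n)) pp; last exact/allP.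
move=> a b an bn /orP[] /eqP ab; apply/orP; [left|right].
  exact: infix_initial_path ab bn.
exact: infix_initial_path ab an.
Qed.

End InitialPath.

(** The second path of a diagonal has distinct vertices in [path_graph r]; initial segments with r
    vertices attain this bound. *)
Lemma diag_grid t r : 0 < r <= t -> diag (path_graph t) (path_graph r) = r.
Proof.
move=> /andP[r0 le_rt]; apply/eqP; rewrite eqn_leq; apply/andP; split.
  apply/bigmax_leqP => D /diagonalP[g [h [_ _ /andP[/and3P[_ uh _] _] ->]]].
  rewrite cardsE; apply: leq_trans (card_size _) _.
  rewrite size_zip; apply: leq_trans (geq_minr _ _) _.
  by rewrite -(card_uniqP uh); apply: leq_trans (max_card _) _; rewrite card_ord.
pose g := initial_path le_rt; pose h := initial_path (leqnn r).
have szgh : size g = size h by rewrite !size_initial_path.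
pose D : {set strong_product (path_graph t) (path_graph r)} := [set z in zip g h].
have diagD : diagonal D.
  by apply/diagonalP; exists g, h; rewrite !convex_initial_path.
apply: leq_trans (leq_bigmax_cond _ diagD); rewrite /D cardsE.
have/card_uniqP -> : uniq (zip g h).
  by apply: (@map_uniq _ _ fst); rewrite -/unzip1 unzip1_zip ?szgh // initial_path_uniq.
by rewrite size_zip szgh minnn size_initial_path.
Qed.

(** * The two families of exact values *)

Theorem theorem5p6 :
  (forall t k : nat, (4 * k <= t)%N -> (8 <= 4 * k)%N ->
     ((chi_mu_i (strong_product (path_graph t) (path_graph (4 * k))))%:R
        = (diag (path_graph t) (path_graph (4 * k)))%:R / 2%:R :> rat)%R
     /\ ((diag (path_graph t) (path_graph (4 * k)))%:R / 2%:R
        = (2 * k)%:R :> rat)%R)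
  /\
  (forall t r : nat, (r <= t)%N -> r \in [:: 3; 4; 5; 6; 7] ->
     chi_mu_i (strong_product (path_graph t) (path_graph r)) = 4).
Proof.
split=> [t k kt k8|t r rt hr].
  have -> : chi_mu_i (grid t (4 * k)) = 2 * k.
    (* The diagonal bound meets the colouring of modulus m = 2 * k, for which 4 * k = 2 * m is the
       largest admissible number of rows. *)
    have := chi_grid_ge_diagonal kt.
    have := @chi_grid_le t (4 * k) (2 * k) ltac:(lia) ltac:(lia) ltac:(lia); lia.
  rewrite diag_grid; last by lia.
  suff -> : ((4 * k)%:R / 2%:R = (2 * k)%:R :> rat)%R by [].
  by rewrite -[4]/(2 * 2) -mulnA mulnC natrM mulfK.
have {}hr : 2 < r < 8 by move: hr; rewrite !inE; lia.
(* The colouring of modulus 4 covers up to 8 rows. *)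
apply/eqP; rewrite eqn_leq chi_grid_le ?chi_grid_ge4; lia.
Qed.
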